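(* Let $n\ge 0$ be an integer and let $Y_n\subset\mathbb{R}^2$ be a $\Pi_n$-poised set. If $\Sigma(x),\Sigma'(x)\in\Pi_1^{(n+1)\times(n+2)}$ are syzygy matrices of rank $n+1$ for two H-bases $(h_0,\dots,h_{n+1})$ and $(h_0',\dots,h_{n+1}')$ of $I(Y_n)$, respectively, then there exist nonsingular scalar matrices $A\in\mathbb{R}^{(n+1)\times(n+1)}$ and $B\in\mathbb{R}^{(n+2)\times(n+2)}$ such that $$\Sigma'(x)=A\,\Sigma(x)\,B,$$ i.e., the linear syzygy matrix of rank $n+1$ for $I(Y_n)$ is unique up to equivalence.
   Context: $\Pi=\mathbb{R}[x_1,x_2]$ is the ring of real bivariate polynomials, and $\Pi_n$ is the vector space of polynomials in $\Pi$ of total degree at most $n$ (with $\Pi_j=\{0\}$ for $j<0$). For $Y\subseteq\mathbb{R}^2$, $I(Y)=\{p\in\Pi : p(y)=0 \text{ for all } y\in Y\}$. A finite set $Y\subset\mathbb{R}^2$ is $\Pi_n$-poised if for every $f\in\mathbb{R}^Y$ there is a unique $p\in\Pi_n$ with $p(y)=f(y)$ for all $y\in Y$. A subset $H$ of an ideal $I\subseteq\Pi$ is an H-basis for $I$ if every $f\in I$ can be written as $f=\sum_{h\in H} g_h h$ with $g_h\in\Pi_{\deg f-\deg h}$ for all $h\in H$. A syzygy of $(p_0,\dots,p_{n+1})\in\Pi^{n+2}$ is a tuple $(\sigma_0,\dots,\sigma_{n+1})\in\Pi^{n+2}$ with $\sum_{i=0}^{n+1}\sigma_i p_i=0$. A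 syzygy matrix $\Sigma\in\Pi_1^{(n+1)\times(n+2)}$ for $(h_0,\dots,h_{n+1})$ is a matrix with entries in $\Pi_1$ each of whose rows is a syzygy of $(h_0,\dots,h_{n+1})$; its rank is understood over the field of rational functions $\mathbb{R}(x_1,x_2)$. ''Scalar matrix'' means a matrix with constant (real) entries. *)

(* Defs.v *)
From HB Require Import structures.
From mathcomp Require Import all_boot all_order all_algebra.
From mathcomp Require Import finmap.
From mathcomp Require Import mpoly.
From mathcomp Require Import reals.

Set Implicit Arguments.
Unset Strict Implicit.
Unset Printing Implicit Defensive.

Import Order.TTheory GRing.Theory Num.Theory.
Local Open Scope ring_scope.

Section Defs.
Variable R : realType.
Local Notation P := {mpoly R[2]}.

(* The value at p = 0 is the junk value 0; it is never relevant below, since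
   Pi_ treats p = 0 separately and, in is_Hbasis, f = 0 is always represented
   by g = 0 and a term with h i = 0 contributes nothing. *)
Definition deg (p : P) : nat := (msize p).-1.

(* Indexed by int, so that Pi_ j = {0} for j < 0. *)
Definition Pi_ (j : int) : {pred P} :=
  [pred p | (p == 0) || ((deg p)%:Z <= j)].

(* Points of R^2 are row vectors; y 0 : 'I_2 -> R lists the coordinates. *)
Definition vanishing_ideal (Y : {fset 'rV[R]_2}) (p : P) : Prop :=
  forall y, y \in Y -> p.@[y 0] = 0.

Definition poised (n : nat) (Y : {fset 'rV[R]_2}) : Prop :=
  forall f : Y -> R, exists! p : P,
    p \in Pi_ n%:Z /\ forall y : Y, p.@[val y 0] = f y.

Definition is_Hbasis (I : P -> Prop) (m : nat) (h : 'I_m -> P) : Prop :=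
  (forall i, I (h i)) /\
  forall f, I f -> exists g : 'I_m -> P,
    (forall i, g i \in Pi_ ((deg f)%:Z - (deg (h i))%:Z)) /\
    f = \sum_i g i * h i.

Definition is_syzygy (m : nat) (p s : 'I_m -> P) : Prop :=
  \sum_i s i * p i = 0.

Definition is_linear_syzygy_matrix (k m : nat) (h : 'I_m -> P)
    (S : 'M[P]_(k, m)) : Prop :=
  (forall i j, S i j \in Pi_ 1) /\ (forall i, is_syzygy h (S i)).

(* Rank over the field R(x_1, x_2) of rational functions. *)
Definition rat_rank (k m : nat) (S : 'M[P]_(k, m)) : nat :=
  \rank (map_mx (@tofrac P) S).

(* "Scalar" means that all entries are constants, unlike a%:M. *)
Definition scalar_matrix (k m : nat) (A : 'M[R]_(k, m)) : 'M[P]_(k, m) :=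
  map_mx (@mpolyC 2 R) A.

End Defs.

(* Main.v *)
Require Import Defs.
From HB Require Import structures.
From mathcomp Require Import all_boot all_order all_algebra.
From mathcomp Require Import finmap.
From mathcomp Require Import mpoly.
From mathcomp Require Import reals.

Set Implicit Arguments.
Unset Strict Implicit.
Unset Printing Implicit Defensive.

Import Order.TTheory GRing.Theory Num.Theory.
Local Open Scope ring_scope.

(* If [I(Y)] vanishes in degree at most [n], then the polynomials
   [H_j = x^j y^(n+1-j) - p_j], where [p_j] interpolates the monomial on [Y] in
   degree at most [n], span [I(Y)] in degree [n+1], and any H-basis with [n+2]
   elements is related to [H] by an invertible scalar matrix.  It thus suffices
   to compare syzygy matrices [T], [T'] of [H].  Comparing coefficients in
   degrees [n+2] and [n+1] shows that a linear syzygy [s] of [H] is determined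
   by the [n+1] coefficients of [x] in [s_0, ..., s_n].  These coefficients
   form invertible real matrices [L], [L'] for [T], [T'], and [T' = A T] with
   [A = L' L^-1]. *)

(** * Monomials in two variables and coefficients of linear polynomials *)

Definition xy (a b : nat) : 'X_{1..2} := (U_(ord0) *+ a + U_(ord_max) *+ b)%MM.

Lemma mdeg_xy a b : mdeg (xy a b) = (a + b)%N.
Proof. by rewrite mdegD !mdegMn !mdeg1 !mul1n. Qed.

Lemma xy_inj a b c d : xy a b = xy c d -> a = c /\ b = d.
Proof.
move=> /mnmP e; move: (e ord0) (e ord_max).
by rewrite !mnmDE !mulmnE !mnm1E /= !mul1n !mul0n !addn0 !add0n.
Qed.

Lemma forall_I2 (Q : 'I_2 -> Prop) : Q ord0 -> Q ord_max -> forall i, Q i.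
Proof.
move=> Q0 Q1 [[|[|i]] lti] //.
- by rewrite (_ : Ordinal lti = ord0) //; apply/val_inj.
- by rewrite (_ : Ordinal lti = ord_max) //; apply/val_inj.
Qed.

Section Polynomials.
Variable R : realType.
Local Notation P := {mpoly R[2]}.
Implicit Types (p q : P).

Lemma Pi_nat n p : (p \in Pi_ n%:Z) = (msize p <= n.+1)%N.
Proof.
rewrite inE /deg lez_nat; have [->|p0] := eqVneq p 0; first by rewrite msize0.
by rewrite /= -ltnS prednK // lt0n msize_poly_eq0.
Qed.

Lemma mcoeff_ge_msize p m : (msize p <= mdeg m)%N -> p@_m = 0.
Proof. by move/msize_mdeg_ge/memN_msupp_eq0. Qed.

Lemma linear_mpolyE p : (msize p <= 2)%N ->
  p = (p@_0%MM)%:MP + p@_U_(ord0) *: 'X_ord0 + p@_U_(ord_max) *: 'X_ord_max.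
Proof.
move=> p2; apply/mpolyP => m; rewrite !mcoeffD !mcoeffZ !mcoeffC !mcoeffX.
case: (ltnP 1 (mdeg m)) => [m2|].
  rewrite mcoeff_ge_msize ?(leq_trans p2) //.
  have [m0|_] := eqVneq m 0%MM; first by move: m2; rewrite m0 mdeg0.
  have [m0|_] := eqVneq U_(ord0)%MM m; first by move: m2; rewrite -m0 mdeg1.
  have [m0|_] := eqVneq U_(ord_max)%MM m; first by move: m2; rewrite -m0 mdeg1.
  by rewrite !mulr0 !addr0.
rewrite leq_eqVlt ltnS leqn0 => /orP[/mdeg1P[i /eqP->]|]; last first.
  by rewrite mdeg_eq0 => /eqP->; rewrite eqxx !mnm1_eq0 mulr1 !mulr0 !addr0.
rewrite mnm1_eq0 !eq_mnm1.
by move: i; apply: forall_I2; rewrite /= ?mulr0 ?mulr1 ?add0r ?addr0.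
Qed.

Lemma mcoeffMXU q (i : 'I_2) m :
  (q * 'X_i)@_m = if (0 < m i)%N then q@_(m - U_(i))%MM else 0.
Proof.
case: ifP => [mi|mi].
  by rewrite -[in LHS](@submK _ U_(i)%MM m) ?lep1mP ?lt0n_neq0 // addmC mcoeffMX.
apply: memN_msupp_eq0; rewrite (perm_mem (msuppMX _ _)).
apply/mapP => -[m' _ /mnmP/(_ i)]; rewrite mnmDE mnm1E eqxx => mE.
by rewrite mE in mi.
Qed.

Lemma mcoeff_linearM p q k l : (msize p <= 2)%N -> (msize q <= k + l)%N ->
  (p * q)@_(xy k l) = p@_U_(ord0) * (if (0 < k)%N then q@_(xy k.-1 l) else 0)
    + p@_U_(ord_max) * (if (0 < l)%N then q@_(xy k l.-1) else 0).
Proof.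
move=> p2 qkl; rewrite [in LHS](linear_mpolyE p2) !mulrDl !mcoeffD mcoeffCM.
rewrite (mcoeff_ge_msize (p := q)) ?mdeg_xy // mulr0 add0r.
rewrite -!scalerAl !mcoeffZ !(mulrC 'X__) !mcoeffMXU.
rewrite /xy !mnmDE !mulmnE !mnm1E /= !mul1n !mul0n !addn0 !add0n.
congr (_ * _ + _ * _).
  by case: k qkl => //= k _; rewrite mulmS -addmA addmC addmK.
by case: l qkl => //= l _; rewrite mulmSr addmA addmK.
Qed.

(** * Linear syzygies of vectors with standard leading forms *)

(* [H i] has leading form [x^i y^(n+1-i)]. *)
Definition standard_leading n (H : 'cV[P]_n.+2) :=
  forall i, (msize (H i 0%R) <= n.+2)%N /\
    forall k, (k <= n.+1)%N -> (H i 0)@_(xy k (n.+1 - k)) = (i == k :> nat)%:R.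

Definition linear_mx m n (T : 'M[P]_(m, n)) := forall i j, (msize (T i j) <= 2)%N.

(* The last column is omitted: its [x]-coefficients vanish when the rows of [T]
   are linear syzygies of a [standard_leading] vector. *)
Definition x_coef m n (T : 'M[P]_(m, n.+2)) : 'M[R]_(m, n.+1) :=
  \matrix_(i, j) (T i (lift ord_max j))@_U_(ord0).

Lemma x_coef_scalarM m k n (A : 'M[R]_(m, k)) (T : 'M[P]_(k, n.+2)) :
  x_coef (scalar_matrix A *m T) = A *m x_coef T.
Proof.
apply/matrixP => i j; rewrite !mxE raddf_sum /=; apply: eq_bigr => l _.
by rewrite !mxE mcoeffCM.
Qed.

Lemma x_coefB m n (S T : 'M[P]_(m, n.+2)) : x_coef (S - T) = x_coef S - x_coef T.
Proof. by apply/matrixP => i j; rewrite !mxE mcoeffB. Qed.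

Lemma linear_mxB m n (S T : 'M[P]_(m, n)) :
  linear_mx S -> linear_mx T -> linear_mx (S - T).
Proof.
move=> lS lT i j; rewrite !mxE; apply: leq_trans (msizeD_le _ _) _.
by rewrite geq_max msizeN lS lT.
Qed.

Lemma linear_mx_scalarM m k n (A : 'M[R]_(m, k)) (T : 'M[P]_(k, n)) :
  linear_mx T -> linear_mx (scalar_matrix A *m T).
Proof.
move=> lT i j; rewrite mxE; apply: leq_trans (msize_sum _ _ _) _.
apply/bigmax_leqP => l _.
by rewrite mxE mul_mpolyC (leq_trans (msizeZ_le _ _)).
Qed.

Lemma linear_mxM_scalar m k n (T : 'M[P]_(m, k)) (A : 'M[R]_(k, n)) :
  linear_mx T -> linear_mx (T *m scalar_matrix A).
Proof.
move=> lT i j; rewrite mxE; apply: leq_trans (msize_sum _ _ _) _.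
apply/bigmax_leqP => l _.
by rewrite mxE mulrC mul_mpolyC (leq_trans (msizeZ_le _ _)).
Qed.

Lemma sum_delta n (f : 'I_n -> R) (k : 'I_n) :
  \sum_(i < n) f i * (i == k :> nat)%:R = f k.
Proof.
rewrite (bigD1 k) //= eqxx mulr1 big1 ?addr0 // => i ik.
by rewrite (negbTE (ik : (i : nat) != k)) mulr0.
Qed.

Lemma linear_syzygy_eq0 m n (H : 'cV[P]_n.+2) (T : 'M[P]_(m, n.+2)) :
  standard_leading H -> linear_mx T -> T *m H = 0 -> x_coef T = 0 -> T = 0.
Proof.
move=> sH lT TH xT; apply/matrixP => i j; rewrite [RHS]mxE.
(* In degree [n+2] only linear parts meet leading forms: the [x]-coefficient of entry [k-1] plus the
   [y]-coefficient of entry [k] is zero, out-of-range entries counting as 0. *)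
have topE k l : (k + l = n.+2)%N ->
    \sum_j ((T i j)@_U_(ord0) *
              (if (0 < k)%N then (H j 0)@_(xy k.-1 l) else 0) +
            (T i j)@_U_(ord_max) *
              (if (0 < l)%N then (H j 0)@_(xy k l.-1) else 0)) = 0.
  move=> kl; move/matrixP/(_ i 0)/(congr1 (mcoeff (xy k l))): TH.
  rewrite !mxE mcoeff0 raddf_sum /= => TH0.
  rewrite -[RHS]TH0; apply: eq_bigr => s _.
  by rewrite mcoeff_linearM // kl (sH s).1.
(* For the last column, the coefficient of [x^(n+2)] isolates the [x]-coefficient. *)
have x0 s : (T i s)@_U_(ord0) = 0.
  case: (unliftP ord_max s) => [s'|] ->.
    by move/matrixP/(_ i s'): xT; rewrite !mxE.
  rewrite -[LHS](sum_delta (fun s => (T i s)@_U_(ord0)) ord_max).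
  rewrite -[RHS](topE n.+2 0%N) ?addn0 //; apply: eq_bigr => r _.
  have := (sH r).2 _ (leqnn _); rewrite subnn => Hr.
  by rewrite /= Hr mulr0 addr0.
have y0 s : (T i s)@_U_(ord_max) = 0.
  rewrite -[LHS](sum_delta (fun s => (T i s)@_U_(ord_max)) s).
  have qn : (s <= n.+1)%N by rewrite -ltnS.
  rewrite -[RHS](topE s (n.+2 - s)%N) ?subnKC ?(ltnW (ltn_ord s)) //.
  apply: eq_bigr => r _.
  by rewrite x0 mul0r add0r subn_gt0 ltn_ord subSn // (sH r).2.
have c0 s : T i s = ((T i s)@_0%MM)%:MP.
  by rewrite {1}(linear_mpolyE (lT i s)) x0 y0 !scale0r !addr0.
(* Only constants remain, and the coefficient of [x^j y^(n+1-j)] isolates the one in column [j]. *)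
rewrite c0; apply/eqP; rewrite mpolyC_eq0; apply/eqP.
rewrite -[LHS](sum_delta (fun s => (T i s)@_0%MM) j).
have jn : (j <= n.+1)%N by rewrite -ltnS.
move/matrixP/(_ i 0)/(congr1 (mcoeff (xy j (n.+1 - j)))): TH.
rewrite !mxE mcoeff0 raddf_sum /= => TH0.
rewrite -[RHS]TH0.
by apply: eq_bigr => r _; rewrite [in RHS]c0 mcoeffCM (sH r).2.
Qed.

Lemma standard_leading_free n (H : 'cV[P]_n.+2) (u : 'rV[R]_n.+2) :
  standard_leading H -> scalar_matrix u *m H = 0 -> u = 0.
Proof.
move=> sH uH; apply/rowP => j; rewrite [RHS]mxE -[LHS](sum_delta (fun s => u 0 s) j).
have jn : (j <= n.+1)%N by rewrite -ltnS.
move/matrixP/(_ 0 0)/(congr1 (mcoeff (xy j (n.+1 - j)))): uH.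
rewrite !mxE mcoeff0 raddf_sum /= => uH0; rewrite -[RHS]uH0.
by apply: eq_bigr => r _; rewrite !mxE mcoeffCM (sH r).2.
Qed.

(** Rows independent over the rational functions are independent over the reals. *)
Lemma rat_rank_free m n (S : 'M[P]_(m, n)) (u : 'rV[R]_m) :
  rat_rank S = m -> scalar_matrix u *m S = 0 -> u = 0.
Proof.
move=> rS /(congr1 (map_mx (@tofrac P))); rewrite map_mxM map_mx0 => /eqP.
rewrite mulmx_free_eq0 /row_free; last by apply/eqP.
move=> /eqP/matrixP u0; apply/rowP => j; move/eqP: (u0 0 j).
by rewrite !mxE tofrac_eq0 mpolyC_eq0 => /eqP.
Qed.

(** * Interpolation on [Y] and base change between H-bases *)

Section Poised.
Variables (n : nat) (Y : {fset 'rV[R]_2}).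
Hypothesis hY : poised n Y.

Lemma vanishing_small_eq0 p :
  vanishing_ideal Y p -> (msize p <= n.+1)%N -> p = 0.
Proof.
move=> Yp pn; have [q [_ qU]] := hY (fun=> 0).
rewrite -(qU p).
  by apply: qU; rewrite Pi_nat msize0; split=> // y; rewrite meval0.
by split=> [|y]; [rewrite Pi_nat | exact/Yp/valP].
Qed.

Lemma standard_leading_exists :
  exists2 H : 'cV[P]_n.+2, standard_leading H & forall i, vanishing_ideal Y (H i 0).
Proof.
pose M (i : 'I_n.+2) : P := 'X_[xy i (n.+1 - i)].
have Hi (i : 'I_n.+2) : exists p, (msize p <= n.+1)%N /\ vanishing_ideal Y (M i - p).
  have [p [[pn pY] _]] := hY (fun y => (M i).@[val y 0]); exists p; split.
    by rewrite -Pi_nat.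
  by move=> y yY; rewrite mevalB (pY [` yY]%fset) subrr.
have [p pP] := fin_all_exists Hi.
exists (\col_i (M i - p i)) => i; rewrite mxE; last exact: (pP i).2.
have iE : (i + (n.+1 - i) = n.+1)%N by rewrite subnKC // -ltnS.
split.
  rewrite (leq_trans (msizeD_le _ _)) // msizeN geq_max msizeX mdeg_xy iE leqnn.
  exact: leqW (pP i).1.
move=> k kn; rewrite mcoeffB mcoeffX (mcoeff_ge_msize (p := p i)).
  rewrite subr0; congr ((nat_of_bool _)%:R); apply/eqP/eqP => [/xy_inj[]//|ik].
  by rewrite /= ik.
by rewrite mdeg_xy subnKC // (pP i).1.
Qed.

(* Every nonzero [h j] has degree at least [n + 1], so the coefficient of [h j]
   in the representation of [H i], which has degree [n + 1], is constant. *)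
Lemma Hbasis_base_change (h : 'I_n.+2 -> P) (H : 'cV[P]_n.+2) :
  is_Hbasis (vanishing_ideal Y) h -> standard_leading H ->
  (forall i, vanishing_ideal Y (H i 0)) ->
  exists2 D : 'M[R]_n.+2, D \in unitmx & H = scalar_matrix D *m \col_i h i.
Proof.
move=> [hI hB] sH HI; have HD (i : 'I_n.+2) : exists d : 'rV[R]_n.+2,
    H i 0 = \sum_j (d 0 j)%:MP * h j.
  have [g [gdeg ->]] := hB _ (HI i).
  (* When [h j = 0], the junk value [deg 0 = 0] does not force [g j] to be constant, so the
     coefficient is set to 0. *)
  exists (\row_j (if h j == 0 then 0 else (g j)@_0%MM)).
  apply: eq_bigr => j _; rewrite mxE; have [->|h0] := eqVneq (h j) 0.
    by rewrite !mulr0.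
  congr (_ * _); apply: msize1_polyC.
  have hn : (n.+1 < msize (h j))%N.
    rewrite ltnNge; apply: contra h0 => hn; apply/eqP.
    exact: vanishing_small_eq0 (hI j) hn.
  suff : g j \in Pi_ 0%:Z by rewrite Pi_nat.
  have := gdeg j; rewrite !inE => /orP[->//|gd]; apply/orP; right.
  rewrite (le_trans gd) // subr_le0 lez_nat /deg.
  apply: (@leq_trans n.+1); last by rewrite -ltnS (ltn_predK hn).
  by have := (sH i).1; case: (msize _).
have [d dP] := fin_all_exists HD.
have HE : H = scalar_matrix (\matrix_i d i) *m \col_i h i.
  apply/matrixP => i k; rewrite [k]ord1 dP mxE.
  by apply: eq_bigr => j _; rewrite !mxE.
exists (\matrix_i d i); last exact: HE.
(* A row killed by [D] would be a real linear relation among the entries of [H], whose leading forms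
   are independent. *)
rewrite -row_free_unit; apply: inj_row_free => u uD.
apply: (standard_leading_free sH).
by rewrite HE mulmxA -map_mxM uD map_mx0 mul0mx.
Qed.

End Poised.

(** If [u] kills [x_coef T], then [u T] is a linear syzygy without [x]-coefficients, hence zero, and
    independence of the rows of [T] gives [u = 0]. *)
Lemma x_coef_unitmx n (H : 'cV[P]_n.+2) (T : 'M[P]_(n.+1, n.+2)) :
    standard_leading H -> linear_mx T -> T *m H = 0 ->
    (forall u : 'rV[R]_n.+1, scalar_matrix u *m T = 0 -> u = 0) ->
  x_coef T \in unitmx.
Proof.
move=> sH lT TH Tfree; rewrite -row_free_unit; apply: inj_row_free => u uT.
apply/Tfree/(linear_syzygy_eq0 sH); first exact: linear_mx_scalarM.
  by rewrite -mulmxA TH mulmx0.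
by rewrite x_coef_scalarM.
Qed.

(** Since [H = D h], syzygies of [h] become syzygies of [H] on right multiplication by the inverse
    of [D]; this keeps entries linear and rows independent. *)
Lemma syzygy_base_change n (h : 'I_n.+2 -> P) (H : 'cV[P]_n.+2)
    (S : 'M[P]_(n.+1, n.+2)) (D : 'M[R]_n.+2) :
    standard_leading H -> D \in unitmx -> H = scalar_matrix D *m \col_i h i ->
    is_linear_syzygy_matrix h S -> rat_rank S = n.+1 ->
  let T := S *m scalar_matrix (invmx D) in
  [/\ linear_mx T, T *m H = 0 & x_coef T \in unitmx].
Proof.
move=> sH uD HE [lS sS] rS T.
have lT : linear_mx T.
  by apply: linear_mxM_scalar => i j; rewrite -Pi_nat lS.
have TD : T *m scalar_matrix D = S.
  by rewrite -mulmxA -map_mxM mulVmx // map_mx1 mulmx1.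
have TH : T *m H = 0.
  rewrite HE mulmxA TD; apply/matrixP => i j; rewrite !mxE -[RHS](sS i).
  by apply: eq_bigr => k _; rewrite mxE.
split=> //; apply: (x_coef_unitmx sH) => // u uT.
by apply: (rat_rank_free rS); rewrite -TD mulmxA uT mul0mx.
Qed.

End Polynomials.

Theorem theorem3p6 (R : realType) (n : nat) (Y : {fset 'rV[R]_2})
    (hY : poised n Y)
    (h h' : 'I_n.+2 -> {mpoly R[2]})
    (hh : is_Hbasis (vanishing_ideal Y) h)
    (hh' : is_Hbasis (vanishing_ideal Y) h')
    (Sigma Sigma' : 'M[{mpoly R[2]}]_(n.+1, n.+2))
    (hS : is_linear_syzygy_matrix h Sigma)
    (hS' : is_linear_syzygy_matrix h' Sigma')
    (rS : rat_rank Sigma = n.+1)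
    (rS' : rat_rank Sigma' = n.+1) :
  exists (A : 'M[R]_n.+1) (B : 'M[R]_n.+2),
    [/\ A \in unitmx, B \in unitmx &
        Sigma' = scalar_matrix A *m Sigma *m scalar_matrix B].
Proof.
have [H sH HI] := standard_leading_exists hY.
have [D uD HE] := Hbasis_base_change hY hh sH HI.
have [D' uD' HE'] := Hbasis_base_change hY hh' sH HI.
have [lT TH uT] := syzygy_base_change sH uD HE hS rS.
have [lT' TH' uT'] := syzygy_base_change sH uD' HE' hS' rS'.
set T := Sigma *m _ in lT TH uT; set T' := Sigma' *m _ in lT' TH' uT'.
pose A := x_coef T' *m invmx (x_coef T).
have T'E : T' = scalar_matrix A *m T.
  apply/eqP; rewrite -subr_eq0; apply/eqP; apply: (linear_syzygy_eq0 sH).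
  - exact: linear_mxB lT' (linear_mx_scalarM _ lT).
  - by rewrite mulmxBl TH' -mulmxA TH mulmx0 subr0.
  - by rewrite x_coefB x_coef_scalarM -mulmxA mulVmx // mulmx1 subrr.
(* Undoing both base changes: [Sigma' = T' D' = A T D'], with [T = Sigma D^-1]. *)
exists A, (invmx D *m D'); split; first by rewrite unitmx_mul uT' unitmx_inv.
  by rewrite unitmx_mul unitmx_inv uD.
have -> : scalar_matrix (invmx D *m D') =
    scalar_matrix (invmx D) *m scalar_matrix D'.
  exact: map_mxM.
rewrite mulmxA -(mulmxA _ Sigma) -/T -T'E -mulmxA.
by rewrite -[_ *m scalar_matrix D']map_mxM mulVmx // map_mx1 mulmx1.
Qed.
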